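(* Let $X$ be a Corson compactum. Then $X^\omega$ has a dense metrizable subspace if and only if $\hat{c}(X^\omega) > w(X)$.
   Context: A compact Hausdorff space $X$ is a Corson compactum if for some cardinal $\kappa$ it is homeomorphic to a subspace of $\Sigma(\mathbb{R}^\kappa)=\{x \in \mathbb{R}^\kappa : |\{\alpha<\kappa: x(\alpha)\neq 0\}| \leq \aleph_0\}$. $w(X)$ is the weight of $X$. A cellular family is a family of pairwise disjoint non-empty open sets; $\hat{c}(Z)$ denotes the least cardinal $\kappa$ such that $Z$ has no cellular family of cardinality $\kappa$. $X^\omega$ carries the product topology. *)

(* Defs.v *)
From HB Require Import structures.
From mathcomp Require Import all_boot all_order all_algebra.
From mathcomp Require Import all_classical all_reals all_analysis.
From mathcomp Require Import Rstruct Rstruct_topology.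
From Stdlib Require Import Rdefinitions.

Set Implicit Arguments.
Unset Strict Implicit.
Unset Printing Implicit Defensive.

Import Order.TTheory GRing.Theory Num.Theory.
Local Open Scope classical_set_scope.
Local Open Scope ring_scope.

Definition in_Sigma (I : Type) (x : I -> R) : Prop :=
  countable [set i | x i <> 0%R].

Definition embedding (X Y : topologicalType) (f : X -> Y) : Prop :=
  injective f /\ continuous f /\
  (forall U : set X, open U ->
     exists V : set Y, open V /\ f @` U = f @` setT `&` V).

Definition corson_compact (X : topologicalType) : Prop :=
  compact [set: X] /\ hausdorff_space X /\
  exists (I : Type) (f : X -> {ptws I -> R}),
    embedding f /\ (forall x, in_Sigma (f x)).

Definition metrizable (T : topologicalType) : Prop :=
  exists d : T -> T -> R,
    (forall x y, (0 <= d x y)%R) /\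
    (forall x y, d x y = 0%R <-> x = y) /\
    (forall x y, d x y = d y x) /\
    (forall x y z, (d x z <= d x y + d y z)%R) /\
    (forall U : set T, open U <->
       (forall x, U x -> exists e : R, (0 < e)%R /\
           [set y | (d x y < e)%R] `<=` U)).

Definition has_dense_metrizable_subspace (Z : topologicalType) : Prop :=
  exists D : set Z, dense D /\ metrizable (set_type D).

Definition cellular (Z : topologicalType) (C : set (set Z)) : Prop :=
  (forall U, C U -> open U /\ U !=set0) /\
  (forall U V, C U -> C V -> U <> V -> U `&` V = set0).

Definition minimal_base (X : topologicalType) (B : set (set X)) : Prop :=
  basis B /\ forall B' : set (set X), basis B' -> (B #<= B')%card.

(* hatc_gt Z A  <->  hat c(Z) > |A|.  Since hat c(Z) is the least cardinal
   kappa such that Z has no cellular family of cardinality kappa, this says: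
   for every cardinal kappa <= |A| (i.e. the cardinality of a subset K of A)
   Z has a cellular family of cardinality kappa. *)
Definition hatc_gt (Z : topologicalType) (T : Type) (A : set T) : Prop :=
  forall K : set T, K `<=` A ->
    exists C : set (set Z), cellular C /\ (C #= K)%card.

(* Main.v *)
(** A compact space [X] with a point-separating family of continuous functions of
countable support has a dense set of points determined by countably many of
these functions, hence of countable character.

If the cells [U b] indexed by a base [B] are disjoint in [X^omega], split [omega]
into infinitely many infinite rows.  For each list [l] of members of [B] pick a
point of [X^omega] of countable character that lies in the box spelled by [l] and
whose rows from some point on lie in the cells [U b] for [b] in [l].  These points
form a dense set, and near each of them [l] is a locally constant function of the
point; so the countable character of the chosen points gives countably many
pseudometrics that define the topology of this set.

Conversely, maximal [1/n]-separated subsets [M n] of a dense metrizable subspace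
give disjoint cells indexed by each [M n], and splitting [omega] into rows gives
disjoint cells indexed by all finite lists over the union of the [M n].  The
supports of the points of this dense union carry enough coordinates to separate
points, so finite lists also index a base of [X]; no cardinal arithmetic is
needed. *)
Require Import Defs.
From HB Require Import structures.
From mathcomp Require Import all_boot all_order all_algebra.
From mathcomp Require Import all_classical all_reals all_analysis.
From mathcomp Require Import Rstruct Rstruct_topology lra.

Set Implicit Arguments.
Unset Strict Implicit.
Unset Printing Implicit Defensive.

Import Order.TTheory GRing.Theory Num.Theory numFieldNormedType.Exports.

Local Open Scope classical_set_scope.
Local Open Scope ring_scope.
Local Open Scope card_scope.
Local Notation R := Rdefinitions.R.

(** * Sets of least cardinality *)

Lemma card_le_inj (T U : Type) (A : set T) (B : set U) (f : T -> U) :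
  (forall a, A a -> B (f a)) ->
  (forall a a', A a -> A a' -> f a = f a' -> a = a') -> A #<= B.
Proof.
move=> fAB finj.
have [g] : $|{injfun A >-> B}|.
  by apply/injfunPex; exists f => // a a' /set_mem Aa /set_mem Aa'; exact: finj.
exact: inj_card_le.
Qed.

(* A maximal family of selectors that pairwise differ on every member of [P]
   must exhaust some [A] in [P]: otherwise one more selector could be added. *)
Lemma exists_card_min (T : Type) (P : set (set T)) :
  P !=set0 -> exists2 A, P A & forall A', P A' -> A #<= A'.
Proof.
move=> [A0 PA0].
have [[A [PA A_empty]]|noempty] := pselect (exists A, P A /\ A = set0).
  by exists A => // A' _; rewrite A_empty card_ge0.
have Pn0 A : P A -> A !=set0.
  by move=> PA; apply/set0P/eqP => A_empty; apply: noempty; exists A.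
have [t0 _] := Pn0 _ PA0.
pose Q (S : set (set T -> T)) :=
  (forall s A, S s -> P A -> A (s A)) /\
  (forall s s' A, S s -> S s' -> P A -> s A = s' A -> s = s').
have [F FQ totF|S [[S_in S_inj] S_max]] := @Zorn_bigcup _ Q.
  split=> [s A [S FS Ss]|s s' A [S FS Ss] [S' FS' Ss']] PA.
    by have [Fin _] := FQ _ FS; exact: Fin s A Ss PA.
  have [/(_ _ Ss) S's|/(_ _ Ss') Ss2] := totF _ _ FS FS'.
    by have [_] := FQ _ FS'; apply.
  by have [_] := FQ _ FS; apply.
have [[A [PA As]]|noA] :=
    pselect (exists A, P A /\ forall a, A a -> exists2 s, S s & s A = a).
  have [a|g gP] := @choice _ _ (fun a h => A a -> S h /\ h A = a).
    by have [/As[s Ss <-]|nAa] := pselect (A a); [exists s|exists (fun=> t0)].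
  exists A => // A' PA'; apply: (@card_le_inj _ _ _ _ (fun a => g a A')) => [a Aa|].
    by have [Sg _] := gP _ Aa; exact: S_in (g a) A' Sg PA'.
  move=> a a' Aa Aa' gaa'.
  rewrite -(gP _ Aa).2 -(gP _ Aa').2.
  by rewrite (S_inj _ _ _ (gP _ Aa).1 (gP _ Aa').1 PA' gaa').
have [A|t tP] := @choice _ _ (fun A a => P A -> A a /\ forall s, S s -> s A <> a).
  have [PA|nPA] := pselect (P A); last by exists t0.
  apply: contrapT => no; apply: noA; exists A; split=> // a Aa.
  apply: contrapT => nos; apply: no; exists a => _; split=> // s Ss sAa.
  by apply: nos; exists s.
exfalso; apply: (S_max (S `|` [set t])).
  split; first by move=> s Ss; left.
  move=> /(_ t (or_intror erefl)) St.
  exact: (tP _ PA0).2 St erefl.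
split=> [s A [Ss|->] PA|s s' A [Ss|->] [Ss'|->] PA] //.
- exact: S_in s A Ss PA.
- by have [] := tP _ PA.
- exact: S_inj PA.
- by move=> e; have [_ /(_ _ Ss)] := tP _ PA.
- by move=> e; have [_ /(_ _ Ss')] := tP _ PA; rewrite e.
Qed.

(** * Metrization by countably many pseudometrics *)

Section metrization.
Variables (T : topologicalType) (rho : nat -> T -> T -> R).
Hypothesis rho_ge0 : forall k x y, 0 <= rho k x y.
Hypothesis rho_xx : forall k x, rho k x x = 0.
Hypothesis rho_sym : forall k x y, rho k x y = rho k y x.
Hypothesis rho_tri : forall k x y z, rho k x z <= rho k x y + rho k y z.
Hypothesis rho_nbhs : forall k x (e : R), 0 < e -> nbhs x [set y | rho k x y < e].
Hypothesis rho_base : forall x (U : set T), open U -> U x ->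
  exists K, exists2 e : R, 0 < e &
    forall y, (forall k, (k < K)%N -> rho k x y < e) -> U y.
Hypothesis rho_sep : forall x y, (forall k, rho k x y = 0) -> x = y.

(** The bounds 1/(k+1) tend to 0, so a supremum can replace a series: a [dist]-ball of given radius
    is controlled by finitely many of the [rho k]. *)
Let trunc k x y : R := Num.min (rho k x y) k.+1%:R^-1.
Let dist x y : R := sup (range (fun k => trunc k x y)).

Let trunc_le k x y : trunc k x y <= k.+1%:R^-1.
Proof. by rewrite ge_min lexx orbT. Qed.

Let trunc_le_dist k x y : trunc k x y <= dist x y.
Proof.
apply: ub_le_sup; last by exists k.
exists 1 => _ [j _ <-]; apply: le_trans (trunc_le j x y) _.
by rewrite invf_le1 ?ler1n // ltr0n.
Qed.

Let dist_le x y (a : R) : (forall k, trunc k x y <= a) -> dist x y <= a.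
Proof.
move=> h; apply: ge_sup; first by exists (trunc 0 x y), 0%N.
by move=> _ [k _ <-].
Qed.

Let trunc_ge0 k x y : 0 <= trunc k x y.
Proof. by rewrite le_min rho_ge0 invr_ge0 ler0n. Qed.

Let dist_sym x y : dist x y = dist y x.
Proof. by rewrite /dist; congr sup; congr image; apply/funext => k; rewrite /trunc rho_sym. Qed.

Let dist_tri x y z : dist x z <= dist x y + dist y z.
Proof.
apply: dist_le => k.
apply: le_trans (lerD (trunc_le_dist k x y) (trunc_le_dist k y z)).
have /ltW k0 : (0 : R) < k.+1%:R^-1 by rewrite invr_gt0 ltr0n.
have := rho_tri k x y z; have := rho_ge0 k x y; have := rho_ge0 k y z.
rewrite /trunc /Num.min; move: k0; move: (k.+1%:R^-1) => b.
by case: ifPn; case: ifPn; case: ifPn; rewrite -?leNgt; lra.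
Qed.

Let dist_eq0 x y : dist x y = 0 <-> x = y.
Proof.
split=> [d0|->].
  apply: rho_sep => k; apply/eqP; rewrite eq_le rho_ge0 andbT.
  have := trunc_le_dist k x y; rewrite d0 /trunc ge_min => /orP[//|].
  by rewrite leNgt invr_gt0 ltr0n.
apply/eqP; rewrite eq_le (le_trans (trunc_ge0 0 y y) (trunc_le_dist 0 y y)) andbT.
by apply: dist_le => k; rewrite /trunc rho_xx ge_min lexx.
Qed.

Let dist_open (U : set T) : open U <->
  forall x, U x -> exists2 e : R, 0 < e & [set y | dist x y < e] `<=` U.
Proof.
split=> [oU x Ux|ballU].
  have [K [e e0 eU]] := rho_base oU Ux.
  (* For [k < K] the bound 1/(k+1) exceeds this radius, so a truncated value below the radius can
     only be [rho k x y]. *)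
  exists (Num.min e K.+1%:R^-1); first by rewrite lt_min e0 invr_gt0 ltr0n.
  move=> y /=; rewrite lt_min => /andP[de dK]; apply: eU => k kK.
  have := trunc_le_dist k x y; rewrite /trunc ge_min => /orP[/le_lt_trans->//|].
  move=> /le_lt_trans/(_ dK); rewrite ltf_pV2 ?posrE ?ltr0n // ltr_nat ltnS.
  by rewrite ltnNge (ltnW kK).
rewrite openE => x /ballU[e e0 eU].
have [K Ke] : exists K : nat, K.+1%:R^-1 < e.
  by have [K] := ltr_add_invr e0; rewrite add0r => Ke; exists K.
rewrite /interior.
have : nbhs x [set y | forall k : 'I_K, rho k x y < e / 2].
  by apply: filter_forall => k; apply: rho_nbhs; rewrite divr_gt0.
apply: filterS => y /= hy; apply: eU => /=.
apply: (@le_lt_trans _ _ (Num.max (e / 2) K.+1%:R^-1)); last first.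
  by rewrite gt_max Ke andbT; lra.
apply: dist_le => k; rewrite le_max.
have [kK|Kk] := ltnP k K.
  by rewrite (le_trans _ (ltW (hy (Ordinal kK)))) // /trunc ge_min lexx.
apply/orP; right; apply: le_trans (trunc_le k x y) _.
by rewrite lef_pV2 ?posrE ?ltr0n // ler_nat ltnS.
Qed.

Lemma metrizable_of_pseudometrics : metrizable T.
Proof.
exists dist; split=> [x y|].
  by apply/RleP; exact: le_trans (trunc_ge0 0 x y) (trunc_le_dist 0 x y).
split; first exact: dist_eq0.
split; first exact: dist_sym.
split=> [x y z|U]; first by apply/RleP; exact: dist_tri.
rewrite dist_open; split=> + x Ux => /(_ x Ux).
  move=> [e e0 eU]; exists e; split; first exact/RltP.
  by move=> y /= /RltP; exact: eU.
move=> [e [/RltP e0 eU]]; exists e => // y /= /RltP; exact: eU.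
Qed.

End metrization.

(** * Points determined by countably many coordinates *)

Lemma continuous_real_near (K : realType) (Z : topologicalType) (f : Z -> K) :
  continuous f -> forall z (e : K), 0 < e -> nbhs z [set y | `|f y - f z| < e].
Proof.
move=> cf z e e0; have /cvgrPdistC_lt := cf z.
by move=> /(_ e e0); apply.
Qed.

Lemma continuous_near (Z : topologicalType) (f : Z -> R) :
  continuous f -> forall z (e : R), 0 < e -> nbhs z [set y | `|f y - f z| < e].
Proof. exact: (@continuous_real_near R). Qed.

(** Otherwise the points outside [W] that nearly agree with [x] on finite subsets of [J] generate a
    proper filter. By compactness it has a cluster point, which agrees with [x] on all of [J] and so
    lies in the open set [W] that the filter avoids. *)
Lemma compact_separating_base (Z : topologicalType) (I : Type)
    (F : I -> Z -> R) (J : set I) (x : Z) (W : set Z) :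
    compact [set: Z] -> (forall i, J i -> continuous (F i)) -> open W ->
    (forall z, (forall i, J i -> F i z = F i x) -> W z) ->
  exists S, [/\ finite_set S, S `<=` J & exists2 e : R, 0 < e &
    forall z, (forall i, S i -> `|F i z - F i x| < e) -> W z].
Proof.
move=> cZ cF oW WJ; apply: contrapT => no.
pose D : set (set I * R) := [set p | [/\ finite_set p.1, p.1 `<=` J & 0 < p.2]].
pose E (p : set I * R) := [set z | ~ W z /\ forall i, p.1 i -> `|F i z - F i x| < p.2].
have FE : Filter (filter_from D E).
  apply: filter_from_filter; first by exists (set0, 1); split=> //=.
  move=> [S1 e1] [S2 e2] [/= fS1 S1J e10] [/= fS2 S2J e20].
  exists (S1 `|` S2, Num.min e1 e2).
    split=> /=; first by rewrite finite_setU.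
      by move=> i [/S1J|/S2J].
    by rewrite lt_min e10.
  move=> z [nWz /= h]; split; split=> // i Si.
    by have := h i (or_introl Si); rewrite lt_min => /andP[].
  by have := h i (or_intror Si); rewrite lt_min => /andP[].
have PE : ProperFilter (filter_from D E).
  apply: filter_from_proper => -[S e] [/= fS SJ e0].
  apply: contrapT => Ee; apply: no; exists S; split=> //; exists e => // z zS.
  by apply: contrapT => nWz; apply: Ee; exists z.
have [z [_ clz]] := cZ _ PE filterT.
suff Wz : W z.
  have [||y [[nWy _] Wy]] := clz (E (set0, 1)) W; last by [].
    by exists (set0, 1) => //; split=> //=.
  exact: open_nbhs_nbhs.
apply: WJ => i Ji; apply/eqP; rewrite -subr_eq0 -normr_le0; apply/ler_addgt0Pr => e e0; rewrite add0r.
have [||y [[_ /(_ i erefl)/= yx] zy]] :=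
    clz (E ([set i], e / 2)) [set y | `|F i y - F i z| < e / 2].
- by exists ([set i], e / 2) => //; split=> //= [j ->//|]; rewrite divr_gt0.
- by apply: continuous_near; [exact: cF|rewrite divr_gt0].
apply: le_trans (ler_distD (F i y) _ _) _.
by rewrite /= distrC in zy; lra.
Qed.

Lemma compact_separating_nat (Z : topologicalType) (F : nat -> Z -> R) (x : Z)
    (W : set Z) :
    compact [set: Z] -> (forall k, continuous (F k)) -> open W ->
    (forall z, (forall k, F k z = F k x) -> W z) ->
  exists K, exists2 e : R, 0 < e &
    forall z, (forall k, (k < K)%N -> `|F k z - F k x| < e) -> W z.
Proof.
move=> cZ cF oW WJ.
have [z zx|S [fS _ [e e0 eW]]] :=
    @compact_separating_base Z nat F setT x W cZ (fun i _ => cF i) oW.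
  by apply: WJ => k; exact: zx.
have /finite_seqP[s Ss] := fS.
exists (\max_(k <- s) k).+1; exists e => // z zK; apply: eW => k.
by rewrite Ss => /= ks; apply: zK; rewrite ltnS; exact: (leq_bigmax_seq k).
Qed.

(** In a compact Hausdorff space this gives countable character: by [compact_separating_nat],
    closeness in finitely many of the [phi k] forces a point into any given open set around [x]. *)
Definition countably_determined (Z : topologicalType) (x : Z) :=
  exists phi : nat -> Z -> R, (forall k, continuous (phi k)) /\
    forall y, (forall k, phi k y = phi k x) -> y = x.

Lemma countably_determinedP (Z : topologicalType) (I : Type) (F : I -> Z -> R)
    (J : set I) (x : Z) :
  (forall i, continuous (F i)) -> countable J ->
  (forall y, (forall i, J i -> F i y = F i x) -> y = x) ->
  countably_determined x.
Proof.
move=> cF /countable_injP[c cinj] Jx.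
have [k|phi phiP] := @choice nat (Z -> R) (fun k f => continuous f /\
    forall i, J i -> c i = k -> f = F i).
  have [[i [Ji ik]]|no] := pselect (exists i, J i /\ c i = k).
    exists (F i); split=> // j Jj jk; congr F; apply: cinj; rewrite ?inE //.
    by rewrite jk.
  (* Numbers that code no member of [J] receive a constant function. *)
  exists (fun=> 0); split=> [z|i Ji ik]; first exact: cvg_cst.
  by exfalso; apply: no; exists i.
exists phi; split=> [k|y yx]; first by have [] := phiP k.
apply: Jx => i Ji; have [_ /(_ i Ji erefl) <-] := phiP (c i).
exact: yx.
Qed.

Section corson.
Variables (Z : topologicalType) (I : Type) (F : I -> Z -> R).
Hypothesis Zcompact : compact [set: Z].
Hypothesis Fcont : forall i, continuous (F i).
Hypothesis Fsep : forall y z, (forall i, F i y = F i z) -> y = z.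
Hypothesis Fcount : forall z, countable [set i | F i z <> 0].

Lemma closed_fiber i (a : R) : closed [set y | F i y = a].
Proof.
rewrite -[X in closed X]setCK; apply: open_closedC.
rewrite openE => y /eqP; rewrite -subr_eq0 -normr_gt0 => ya.
apply: filterS (continuous_near (@Fcont i) y ya) => z /= + za.
by rewrite za distrC ltxx.
Qed.

(* A point that is maximal for "[y] extends [x]", i.e. [y] agrees with [x] on
   the support of [x], is the only point agreeing with it on its support. *)
Lemma dense_countably_determined : dense [set z : Z | countably_determined z].
Proof.
move=> W [w Ww] oW.
have [z zw|J [fJ _ [e e0 eW]]] :=
    @compact_separating_base Z I F setT w W Zcompact (fun i _ => @Fcont i) oW.
  by rewrite (@Fsep z w) // => i; exact: zw.
(* Fixing the finitely many coordinates in [J] already keeps a point inside [W], so the maximal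
   point is sought in the closed set [A]. *)
pose A := [set z | forall i, J i -> F i z = F i w].
have clA : closed A.
  rewrite (_ : A = \bigcap_(i in J) [set y | F i y = F i w]) //.
  by apply: closed_bigI => i _; exact: closed_fiber.
pose ext (x : Z) := [set y | forall i, F i x <> 0 -> F i y = F i x].
have clext x : closed (ext x).
  rewrite (_ : ext x = \bigcap_(i in [set i | F i x <> 0]) [set y | F i y = F i x]) //.
  by apply: closed_bigI => i _; exact: closed_fiber.
have ext_trans x y z : ext x y -> ext y z -> ext x z.
  by move=> xy yz i xi; rewrite yz xy.
pose le (x y : set_type A) := `[< ext (val x) (val y) >].
have [||||x xmax] := @Zorn (set_type A) le.
- by move=> x; apply/asboolP.
- by move=> x y z /asboolP xy /asboolP yz; apply/asboolP; exact: ext_trans yz.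
- move=> x y /asboolP xy /asboolP yx; apply/val_inj/Fsep => i.
  have [yi0|/eqP/yx//] := eqVneq (F i (val y)) 0.
  by have [xi0|/eqP/xy//] := eqVneq (F i (val x)) 0; rewrite xi0 yi0.
- move=> C totC.
  have [[c0 Cc0]|Cempty] := pselect (C !=set0); last first.
    have Aw : A w by [].
    by exists (SigSub (mem_set Aw)) => s Cs; exfalso; apply: Cempty; exists s.
  (* These closed sets are nested along the chain, so compactness gives a common point, which is an
     upper bound of the chain. *)
  have FF : ProperFilter (filter_from C (fun c => A `&` ext (val c))).
    apply: filter_from_proper => [|c _]; last first.
      by exists (val c); split=> //; exact: set_valP.
    apply: filter_from_filter; first by exists c0.
    move=> c d Cc Cd; have [/asboolP cd|/asboolP dc] := totC _ _ Cc Cd.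
      by exists d => // z [Az dz]; split; split=> //; exact: ext_trans dz.
    by exists c => // z [Az cz]; split; split=> //; exact: ext_trans cz.
  have [z [_]] := Zcompact FF filterT.
  rewrite clusterE => clz.
  have zC c : C c -> (A `&` ext (val c)) z.
    move=> Cc; have /closure_id -> : closed (A `&` ext (val c)) by exact: closedI.
    by apply: clz; exists c.
  exists (SigSub (mem_set (zC _ Cc0).1)) => c Cc; apply/asboolP.
  by have [] := zC c Cc.
exists (val x); split.
  by apply: eW => i Ji; rewrite (set_valP x) // subrr normr0.
(* A point that agrees with [x] on these coordinates lies in [A] and extends [x], so maximality
   identifies it with [x]. *)
apply: (@countably_determinedP Z I F (J `|` [set i | F i (val x) <> 0])) => //.
  rewrite -bigcup2E; apply: bigcup_countable => // -[|[|n]] _ //=.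
  exact: finite_set_countable.
move=> y yx.
have Ay : A y by move=> i Ji; rewrite yx; [exact: (set_valP x)|left].
have := xmax (SigSub (mem_set Ay)) => /(_ _)/(congr1 val); apply.
by apply/asboolP => i xi; apply: yx; right.
Qed.

End corson.

(** * Metrization by locally constant labels *)

Lemma nat_pairing : exists enc : nat * nat -> nat, exists2 dec : nat -> nat * nat,
  cancel enc dec & cancel dec enc.
Proof.
have /ppcard_eqP[f] := card_nat2.
exists f, f^-1%FUN => x; first by rewrite funK ?inE.
by rewrite invK ?inE.
Qed.

Lemma nat_bound (f : nat -> nat) (n : nat) :
  exists N, forall k, (k < n)%N -> (f k < N)%N.
Proof.
exists (\max_(k < n) f k).+1 => k kn.
by rewrite ltnS (leq_bigmax (Ordinal kn)).
Qed.

Lemma open_forall_lt (Z : topologicalType) (n : nat) (P : nat -> set Z) :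
  (forall i, (i < n)%N -> open (P i)) ->
  open [set z | forall i, (i < n)%N -> P i z].
Proof.
move=> oP; rewrite openE => z Pz; rewrite /interior.
have : nbhs z [set z' | forall i : 'I_n, P i z'].
  apply: filter_forall => i; apply: open_nbhs_nbhs.
  by split; [exact: oP|exact: Pz].
by apply: filterS => z' h i ilt; exact: (h (Ordinal ilt)).
Qed.

Section metrization_by_labels.
Variables (T : topologicalType) (L : Type).
Variables (lab : nat -> T -> L) (g : nat -> L -> nat -> T -> R).
Hypothesis lab_near : forall n x, nbhs x [set y | lab n y = lab n x].
Hypothesis g_cont : forall n s k, continuous (g n s k).
Hypothesis g_base : forall x (U : set T), open U -> U x ->
  exists n K, exists2 e : R, 0 < e & forall y, lab n y = lab n x ->
    (forall k, (k < K)%N -> `|g n (lab n x) k y - g n (lab n x) k x| < e) -> U y.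
Hypothesis T_sep : forall x y : T, x <> y -> exists U : set T, [/\ open U, U x & ~ U y].

(** The functions compared may depend on the label: they are used only when both points carry the
    same one, which keeps [rho] symmetric. Different labels put points at the maximal distance 1. *)
Let rho (p : nat * nat) (x y : T) : R :=
  if `[< lab p.1 y = lab p.1 x >] then
    Num.min 1 `|g p.1 (lab p.1 x) p.2 y - g p.1 (lab p.1 x) p.2 x|
  else 1.

Lemma metrizable_of_labels : metrizable T.
Proof.
have [enc [dec encK _]] := nat_pairing.
have rho_base x (U : set T) : open U -> U x ->
  exists K, exists2 e : R, 0 < e &
    forall y, (forall k, (k < K)%N -> rho (dec k) x y < e) -> U y.
  move=> oU Ux; have [n [K [e e0 eU]]] := g_base oU Ux.
  (* The bound [K.+1] keeps the index [(n, 0)] in range even for [K = 0]; a value below 1 there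
     forces equal labels. *)
  have [M encM] := nat_bound (fun k => enc (n, k)) K.+1.
  exists M, (Num.min 1 e); first by rewrite lt_min ltr01.
  move=> y ry.
  have rk k : (k < K.+1)%N -> rho (n, k) x y < Num.min 1 e.
    by move=> kK; rewrite -(encK (n, k)); apply: ry; exact: encM.
  have labE : lab n y = lab n x.
    have := rk 0%N erefl; rewrite /rho /=; case: asboolP => // _.
    by rewrite lt_min ltxx.
  apply: eU => // k kK; have := rk k (ltnW kK).
  rewrite /rho /=; case: asboolP => // _; rewrite lt_min => /andP[].
  rewrite gt_min ltxx /= => g1; rewrite gt_min => /orP[|//].
  exact: lt_trans.
apply: (@metrizable_of_pseudometrics T (fun k => rho (dec k))) => //.
- by move=> k x y; rewrite /rho; case: asboolP; rewrite // le_min ler01 normr_ge0.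
- move=> k x; rewrite /rho; case: asboolP => // _.
  by rewrite subrr normr0 minEle ler10.
- move=> k x y; rewrite /rho; case: asboolP => [->|nxy].
    by case: asboolP => // _; rewrite distrC.
  by case: asboolP => // yx; exfalso; apply: nxy.
- move=> k x y z; move: (dec k) => p; rewrite /rho.
  have min_le1 (a : R) : Num.min 1 a <= 1 by rewrite ge_min lexx.
  have min_ge0 (a : R) : 0 <= a -> 0 <= Num.min 1 a by rewrite le_min ler01.
  case: (asboolP (lab p.1 y = _)) => [->|nyx]; last first.
    apply: (@le_trans _ _ 1); first by case: asboolP.
    by rewrite lerDl; case: asboolP => // _; exact: min_ge0.
  case: asboolP => zx; last by rewrite lerDr; exact: min_ge0.
  have := ler_distD (g p.1 (lab p.1 x) p.2 y) (g p.1 (lab p.1 x) p.2 z) (g p.1 (lab p.1 x) p.2 x).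
  move: (normr_ge0 (g p.1 (lab p.1 x) p.2 z - g p.1 (lab p.1 x) p.2 y)).
  move: (normr_ge0 (g p.1 (lab p.1 x) p.2 y - g p.1 (lab p.1 x) p.2 x)).
  move: `|_| `|_| `|_| => a b c a0 b0 abc.
  by case: (leP 1 a); case: (leP 1 b); case: (leP 1 c); lra.
- move=> k x e e0; move: (dec k) => p.
  have := @continuous_near _ _ (@g_cont p.1 (lab p.1 x) p.2) x e e0.
  apply: filterS2 (lab_near p.1 x) => y /= labE ge; rewrite /rho.
  by case: asboolP => // _; rewrite gt_min ge orbT.
- move=> x y xy0; apply: contrapT => xy; have [U [oU Ux nUy]] := T_sep xy.
  have [K [e e0 eU]] := rho_base x U oU Ux.
  by apply: nUy; apply: eU => k _; rewrite xy0.
Qed.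

End metrization_by_labels.

(* [O] consists of the points near which the index of the cell is constant. *)
Lemma cell_index (Z : topologicalType) (T : Type) (A : set T) (U : T -> set Z) :
  (forall t, A t -> open (U t)) -> trivIset A U ->
  exists2 c : Z -> option T, (forall t z, A t -> U t z -> c z = Some t) &
  let O := [set z | nbhs z [set z' | c z' = c z]] in open O /\ dense O.
Proof.
move=> oU tU.
have [z|c cP] := @choice Z (option T) (fun z o =>
    (forall t, A t -> U t z -> o = Some t) /\
    ((forall t, A t -> ~ U t z) -> o = None)).
  have [[t [At Utz]]|no] := pselect (exists t, A t /\ U t z).
    exists (Some t); split=> [t' At' Ut'z|/(_ t At)//].
    by congr Some; apply: tU => //; exists z.
  by exists None; split=> // t At Utz; exfalso; apply: no; exists t.
exists c => [t z At Utz|O]; first by have [+ _] := cP z; apply.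
split=> [|W [w Ww] oW].
  rewrite openE => z; rewrite /O /= nbhsE => -[V [oV Vz] Vc].
  rewrite /interior nbhsE; exists V => // z' Vz' /=.
  rewrite nbhsE; exists V => // z'' Vz''.
  by rewrite /= (Vc _ Vz'') (Vc _ Vz').
(* Either [W] meets a cell, on which [c] is constant, or [c] is [None] throughout [W]. *)
have [[t [At [z [Wz Utz]]]]|no] := pselect (exists t, A t /\ (W `&` U t) !=set0).
  exists z; split=> //; rewrite /O /=.
  have -> : c z = Some t by have [+ _] := cP z; apply.
  have : nbhs z (U t) by apply: open_nbhs_nbhs; split=> //; exact: oU.
  by apply: filterS => z' Utz'; have [+ _] := cP z'; apply.
have cW z : W z -> c z = None.
  move=> Wz; have [_] := cP z; apply => t At Utz.
  by apply: no; exists t; split=> //; exists z.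
exists w; split=> //; rewrite /O /= (cW _ Ww).
have : nbhs w W by exact: open_nbhs_nbhs.
by apply: filterS => z /cW.
Qed.

(** * Countable powers of a space *)

Section sequences.
Variable X : topologicalType.
Local Notation Y := {ptws nat -> X}.

Lemma ptws_eval_continuous n : continuous (fun y : Y => y n).
Proof. exact: (@proj_continuous nat (fun=> X) n). Qed.

Lemma ptws_continuous (Z : topologicalType) (g : Z -> Y) :
  (forall n, continuous (fun z => g z n)) -> continuous g.
Proof.
move=> gc z; apply/cvg_sup => n U [V [[W oW <-] Wz VU]].
apply: (filterS VU); apply: (gc n z).
exact: open_nbhs_nbhs.
Qed.

(** The boxes around [y] that restrict finitely many coordinates generate a filter; it converges to
    [y] because it does so in each coordinate, hence it contains [W]. *)
Lemma ptws_box (W : set Y) (y : Y) : open W -> W y ->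
  exists n (V : nat -> set X), (forall k, open (V k) /\ V k (y k)) /\
    forall y' : Y, (forall k, (k < n)%N -> V k (y' k)) -> W y'.
Proof.
move=> oW Wy.
pose D := [set p : nat * (nat -> set X) | forall k, open (p.2 k) /\ p.2 k (y k)].
pose E p : set Y := [set y' : Y | forall k, (k < p.1)%N -> p.2 k (y' k)].
have FE : Filter (filter_from D E).
  apply: filter_from_filter.
    by exists (0%N, fun=> setT) => k; split=> //; exact: openT.
  move=> [n V] [n' V'] DV DV'.
  exists (maxn n n', fun k => V k `&` V' k).
    move=> k; have [/= oV Vy] := DV k; have [/= oV' Vy'] := DV' k.
    by split=> //; exact: openI.
  move=> z h; split=> k kn; have [] // := h k _.
    by rewrite /= leq_max kn.
  by rewrite /= leq_max kn orbT.
have cE : filter_from D E --> (y : Y).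
  apply/cvg_sup => n U [V [[V' oV' <-] Vy VU]].
  apply: (filterS VU).
  exists (n.+1, fun k => if k == n then V' else setT).
    by move=> k /=; case: eqP => [->|_]; split=> //; exact: openT.
  by move=> z /(_ n (ltnSn n)) /=; rewrite eqxx.
have [[n V] DV EW] : filter_from D E W by apply: cE; exact: open_nbhs_nbhs.
by exists n, V; split.
Qed.

Lemma ptws_compact : compact [set: X] -> compact [set: Y].
Proof.
move=> cX; have := @tychonoff nat (fun=> X) (fun=> setT) (fun=> cX).
by congr compact; apply/seteqP; split.
Qed.

Lemma ptws_dense (S : set X) : dense S ->
  dense [set y : Y | forall k, S (y k)].
Proof.
move=> dS W [y Wy] oW; have [n [V [VP VW]]] := ptws_box oW Wy.
have [k|z zP] := @choice nat X (fun k x => V k x /\ S x).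
  have [oV Vy] := VP k.
  by apply: dS => //; exists (y k).
exists z; split; last by move=> k; have [] := zP k.
by apply: VW => k _; have [] := zP k.
Qed.

Lemma ptws_countably_determined (y : Y) :
  (forall k, countably_determined (y k)) -> countably_determined y.
Proof.
move=> /choice[phi phiP].
apply: (@countably_determinedP Y (nat * nat)%type
  (fun p z => phi p.1 p.2 (z p.1)) setT) => //.
  move=> [k j] z; apply: continuous_comp; first exact: ptws_eval_continuous.
  by have [+ _] := phiP k; apply.
move=> z zy; apply/funext => k.
by have [_] := phiP k; apply => j; exact: (zy (k, j)).
Qed.

End sequences.

(** * From disjoint cells to a dense metrizable subspace *)

Section dense_metrizable.
Variables (X : topologicalType) (B : set (set X)).
Local Notation Y := {ptws nat -> X}.
Hypothesis Xcompact : compact [set: X].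
Hypothesis Xhausdorff : hausdorff_space X.
Hypothesis Xdense : dense [set x : X | countably_determined x].
Hypothesis Bbasis : basis B.
Variable U : set X -> set Y.
Hypothesis Uopen : forall b, B b -> open (U b) /\ U b !=set0.
Hypothesis Utriv : trivIset B U.

Variables (enc : nat * nat -> nat) (dec : nat -> nat * nat).
Hypotheses (encK : cancel enc dec) (decK : cancel dec enc).

Let row (i : nat) (y : Y) : Y := fun m => y (enc (i, m)).

Let row_continuous i : continuous (row i).
Proof. by apply: ptws_continuous => n; exact: ptws_eval_continuous. Qed.

(** These lists spell non-empty boxes; a base may contain the empty set, hence the second clause. *)
Let good (l : seq (set X)) :=
  forall k, (k < size l)%N -> B (nth set0 l k) /\ nth set0 l k !=set0.

Lemma dense_countably_determined_ptws :
  dense [set y : Y | forall k, countably_determined (y k)].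
Proof. exact: ptws_dense. Qed.

(* The rows [N, ..., N + size l - 1] of [d] spell out the list [l] through the
   cells, while the coordinates of [d] below [size l] lie in rows below [N]. *)
Let coded_point (x0 : X) (c : Y -> option (set X)) (N : nat) (l : seq (set X)) :
  (forall b y, B b -> U b y -> c y = Some b) ->
  open [set z | nbhs z [set z' | c z' = c z]] ->
  dense [set z | nbhs z [set z' | c z' = c z]] ->
  (forall k, (k < size l)%N -> ((dec k).1 < N)%N) ->
  good l ->
  exists d : Y, [/\ forall k, (k < size l)%N -> nth set0 l k (d k),
    forall k, countably_determined (d k),
    forall j, nbhs (row j d) [set z | c z = c (row j d)] &
    forall i, (i < size l)%N -> c (row (N + i) d) = Some (nth set0 l i)].
Proof.
set O := [set z | _] => cU oO dO Nl gl.
have [j|z zP] := @choice nat Y (fun j z => [/\ forall m, countably_determined (z m),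
    O z, forall k, (k < size l)%N -> (dec k).1 = j -> nth set0 l k (z (dec k).2) &
    forall i, (i < size l)%N -> j = (N + i)%N -> c z = Some (nth set0 l i)]).
  (* The rows are chosen independently. Row [N + i] goes into the cell of the [i]-th entry and meets
     no condition from the box, whose coordinates lie in rows before [N]. Any other row is taken in
     [O], subject to the conditions that the box imposes on it. *)
  have [[i [il ji]]|noi] := pselect (exists i, (i < size l)%N /\ j = (N + i)%N).
    have [Bi _] := gl i il; have [oU nU] := Uopen Bi.
    have [z [Uz zd]] := dense_countably_determined_ptws nU oU.
    exists z; split=> //.
    - rewrite /O /= (cU _ _ Bi Uz).
      have : nbhs z (U (nth set0 l i)) by exact: open_nbhs_nbhs.
      by apply: filterS => z' /(cU _ _ Bi).
    - by move=> k /Nl kN kj; move: kN; rewrite kj ji ltnNge leq_addr.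
    - by move=> i' i'l; rewrite ji => /addnI <-; exact: cU.
  pose box : set Y := [set z : Y | forall k, (k < size l)%N ->
    (dec k).1 = j -> nth set0 l k (z (dec k).2)].
  have obox : open box.
    apply: open_forall_lt => k kl; have [kj|kj] := eqVneq (dec k).1 j.
      rewrite [X in open X](_ : _ = (fun y : Y => y (dec k).2) @^-1` nth set0 l k).
        apply: open_comp => [y _|]; first exact: ptws_eval_continuous.
        by have [Bk _] := gl k kl; have [+ _] := Bbasis; apply.
      by apply/seteqP; split=> y /=; [apply|].
    rewrite [X in open X](_ : _ = setT); first exact: openT.
    by apply/seteqP; split=> y //= _ /eqP; rewrite (negbTE kj).
  have nbox : box !=set0.
    have [m|p pP] := @choice nat X (fun m x => (enc (j, m) < size l)%N ->
        nth set0 l (enc (j, m)) x).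
      have [ml|] := boolP (enc (j, m) < size l)%N; last by exists x0.
      by have [_ [x lx]] := gl _ ml; exists x.
    exists p => k kl kj; have := pP (dec k).2.
    by rewrite -kj -surjective_pairing decK; exact.
  have [z [[boxz Oz] zd]] := dense_countably_determined_ptws (dO _ nbox obox)
    (openI obox oO).
  by exists z; split=> // i il ji; exfalso; apply: noi; exists i.
pose d : Y := fun k => z (dec k).1 (dec k).2.
have rowd j : row j d = z j by apply/funext => m; rewrite /row /d encK.
exists d; split.
- by move=> k kl; have [_ _ + _] := zP (dec k).1; apply.
- by move=> k; have [+ _ _ _] := zP (dec k).1; apply.
- by move=> j; rewrite rowd; have [] := zP j.
- by move=> i il; rewrite rowd; have [_ _ _] := zP (N + i)%N; apply.
Qed.

Lemma ptws_dense_metrizable (x0 : X) : has_dense_metrizable_subspace Y.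
Proof.
have oB b : B b -> open b by have [+ _] := Bbasis; apply.
have [c cU [oO dO]] := cell_index (fun b Bb => (Uopen Bb).1) Utriv.
have /choice[N NP] : forall n, exists N, forall k, (k < n)%N -> ((dec k).1 < N)%N.
  by move=> n; exact: nat_bound.
have [l|dd ddP] := @choice (seq (set X)) Y (fun l d => good l ->
    [/\ forall k, (k < size l)%N -> nth set0 l k (d k),
    forall k, countably_determined (d k),
    forall j, nbhs (row j d) [set z | c z = c (row j d)] &
    forall i, (i < size l)%N -> c (row (N (size l) + i) d) = Some (nth set0 l i)]).
  have [gl|] := pselect (good l); last by exists (fun=> x0).
  have [d dP] := coded_point x0 cU oO dO (NP _) gl.
  by exists d.
have [l|phi phiP] := @choice (seq (set X)) (nat -> Y -> R) (fun l phi =>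
    (forall k, continuous (phi k)) /\
    (good l -> forall y, (forall k, phi k y = phi k (dd l)) -> y = dd l)).
  have [gl|ngl] := pselect (good l); last first.
    by exists (fun _ _ => 0); split=> [k|/ngl//]; exact: cst_continuous.
  have [_ /ptws_countably_determined[phi [phic phid]] _ _] := ddP l gl.
  by exists phi; split.
pose D : set Y := dd @` good.
(* When [n] is the length of the list behind [y], this label is the list itself, and [g] then
   selects the functions that determine [y]. That length is not known from [y] beforehand, so every
   [n] gets a label. *)
pose lab n (y : set_type D) := [seq c (row (N n + i) (val y)) | i <- iota 0 n].
pose g (n : nat) (s : seq (option (set X))) k (y : set_type D) : R :=
  phi (pmap id s) k (val y).
have lab_dd l (y : set_type D) : good l -> dd l = val y -> lab (size l) y = map Some l.
  move=> gl ly; apply: (@eq_from_nth _ None); rewrite !size_map size_iota // => i il.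
  rewrite (nth_map 0%N) ?size_iota // nth_iota // add0n (nth_map set0) //.
  by have [_ _ _] := ddP l gl; rewrite -ly; apply.
have val_cont : continuous (val : set_type D -> Y) by exact: initial_continuous.
have YH : hausdorff_space Y by exact: hausdorff_product.
exists D; split.
  (* Density: a box around [y] shrinks to one spelled by a list of [n] members of the base, and the
     point coded by that list lies in it. *)
  move=> W [y Wy] oW; have [n [V [VP VW]]] := ptws_box oW Wy.
  have [k|b bP] := @choice nat (set X) (fun k b => [/\ B b, b (y k) & b `<=` V k]).
    have [_ Bn] := Bbasis; have [b [Bb bx] bV] := Bn (y k) (V k) (open_nbhs_nbhs (VP k)).
    by exists b.
  pose l := mkseq b n.
  have gl : good l.
    move=> k; rewrite size_mkseq => kn; rewrite nth_mkseq //.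
    by have [Bb by_ _] := bP k; split=> //; exists (y k).
  exists (dd l); split; last by exists l.
  apply: VW => k kn; have [bV _ _ _] := ddP l gl.
  have := bV k; rewrite size_mkseq nth_mkseq // => /(_ kn).
  by have [_ _] := bP k; apply.
apply: (@metrizable_of_labels (set_type D) (seq (option (set X))) lab g).
(* [c] is constant near every row of a coded point, so [lab n] is locally constant for each [n],
   whatever the length of the list. *)
- move=> n y; have [l gl ly] := set_valP y.
  pose S := [set z : Y | forall i : 'I_n,
    c (row (N n + i) z) = c (row (N n + i) (val y))].
  have nS : nbhs (val y) S.
    apply: (@filter_forall Y 'I_n (fun i z =>
      c (row (N n + i) z) = c (row (N n + i) (val y))) (nbhs (val y : Y))) => i.
    have [_ _ /(_ (N n + i)%N) + _] := ddP l gl; rewrite ly.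
    by move=> /row_continuous.
  have : nbhs y (val @^-1` S) by exact: val_cont nS.
  apply: filterS => z h.
  apply/eq_in_map => i; rewrite mem_iota add0n => /= il.
  exact: (h (Ordinal il)).
- move=> n s k y; apply: continuous_comp; first exact: val_cont.
  by have [+ _] := phiP (pmap id s); apply.
- move=> y V oV Vy; have [l gl ly] := set_valP y.
  case: oV Vy => W oW <- Wy.
  (* Since [phi l] determines [dd l] in the compact space [Y], finitely many of its functions force
     a point into [W]. *)
  have [phic phid] := phiP l.
  have [z zy|K [e e0 eW]] := @compact_separating_nat Y (phi l) (val y) W
      (ptws_compact Xcompact) phic oW.
    by rewrite (phid gl z) -?ly // in Wy *; rewrite ly.
  exists (size l), K, e => // z _; rewrite (lab_dd l) // /g => h.
  apply: eW => k kK; have := h k kK.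
  rewrite (_ : pmap id (map Some l) = l) //.
  by elim: (l) => //= a s ->.
- move=> y z /eqP yz; move: YH; rewrite open_hausdorff.
  have yz' : val y != val z by [].
  move=> /(_ _ _ yz')[[V V'] /= [Vy V'z] [oV oV' /eqP VV']].
  exists (val @^-1` V); split.
  + by exists V.
  + exact: set_mem.
  + move=> Vz; have : (V `&` V') (val z) by split=> //; exact: set_mem.
    by rewrite VV'.
Qed.

End dense_metrizable.

(** * Cellular families indexed by finite lists *)

(** This is an indexed form of [cellular]: as the cells are non-empty and disjoint, distinct indices
    give distinct cells, so the family has the cardinality of [A]. *)
Definition cellular_on (Z : topologicalType) (T : Type) (A : set T) (U : T -> set Z) :=
  (forall t, A t -> open (U t) /\ U t !=set0) /\ trivIset A U.

Lemma hatc_gt_cellular_on (Z : topologicalType) (T T' : Type) (A : set T)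
    (U : T -> set Z) (B : set T') :
  cellular_on A U -> B #<= A -> hatc_gt Z B.
Proof.
move=> [oU tU] BA K KB.
have /card_subP[L LK LA] := card_le_trans (subset_card_le KB) BA.
exists (U @` L); split.
  split=> [_ [t Lt <-]|_ _ [t Lt <-] [s Ls <-] ts]; first by apply: oU; exact: LA.
  apply: contrapT => /eqP/set0P ts0; apply: ts.
  by congr U; apply: tU => //; exact: LA.
apply: card_eq_trans LK; apply: inj_card_eq => t s /set_mem Lt /set_mem Ls UE.
apply: tU; [exact: LA|exact: LA|].
by rewrite -UE setIid; have [] := oU t (LA _ Lt).
Qed.

(** It is enough to exhibit some base no larger than [A]: a base of least cardinality exists and is
    no larger either. *)
Lemma hatc_gt_min_base (Z : topologicalType) (X : topologicalType) (T : Type)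
    (A : set T) (U : T -> set Z) (B' : set (set X)) :
  basis B' -> B' #<= A -> cellular_on A U ->
  exists B : set (set X), minimal_base B /\ hatc_gt Z B.
Proof.
move=> bB' B'A cU.
have [|B bB Bmin] := @exists_card_min (set X) (@basis X); first by exists B'.
exists B; split; first by split.
by apply: hatc_gt_cellular_on cU (card_le_trans (Bmin _ bB') B'A).
Qed.

(** Balls of radius 1/(2(n+1)) around a 1/(n+1)-separated set are disjoint. Maximality of [M n] puts
    one of its points within 1/(n+1) of any given point, so the union is dense. *)
Lemma metrizable_cellular_on (T : topologicalType) : metrizable T ->
  exists (M : nat -> set T) (V : nat -> T -> set T),
    [/\ forall n e, M n e -> open (V n e) /\ V n e e,
        forall n, trivIset (M n) (V n) & dense (\bigcup_n M n)].
Proof.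
move=> [d [d_ge0 [d_eq0 [d_sym [d_tri d_open]]]]].
have dxx x : d x x = 0 by exact/d_eq0.
have tri x y z : d x z <= d x y + d y z by apply/RleP; exact: d_tri.
have {}d_open (U : set T) : open U <->
    (forall x, U x -> exists2 e : R, 0 < e & [set y | d x y < e] `<=` U).
  rewrite d_open; split=> + x Ux => /(_ x Ux).
    move=> [e [/RltP e0 eU]]; exists e => // y /= /RltP; exact: eU.
  by move=> [e e0 eU]; exists e; split; [exact/RltP|move=> y /= /RltP; exact: eU].
pose V n e : set T := [set y | d e y < n.+1%:R^-1 / 2].
pose sep n (S : set T) := forall x y, S x -> S y -> d x y < n.+1%:R^-1 -> x = y.
have half n : (0 : R) < n.+1%:R^-1 / 2 by rewrite divr_gt0 ?invr_gt0 ?ltr0n.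
have [n|M MP] := @choice nat (set T) (fun n S => sep n S /\
    forall S', S `<` S' -> ~ sep n S').
  apply: Zorn_bigcup => F Fsep totF x y [S FS Sx] [S' FS' S'y].
  have [/(_ _ Sx) S'x|/(_ _ S'y) Sy] := totF _ _ FS FS'; first exact: Fsep FS' _ _ _ _.
  exact: Fsep FS _ _ _ _.
exists M, V; split=> [n e _|n e e' Me Me' [y [ey e'y]]|].
- split; last by rewrite /V /= dxx.
  apply/d_open => x /= ex; exists (n.+1%:R^-1 / 2 - d e x); first by rewrite subr_gt0.
  by move=> y /= xy; apply: le_lt_trans (tri e x y) _; rewrite -ltrBrDl.
- have [+ _] := MP n; apply => //.
  by apply: le_lt_trans (tri e y e') _; rewrite (d_sym y e') [ltRHS]splitr ltrD.
- move=> O [x Ox] /d_open/(_ x Ox)[r r0 rO].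
  have [n nr] : exists n : nat, n.+1%:R^-1 < r.
    by have [n] := ltr_add_invr r0; rewrite add0r => nr; exists n.
  have [[y [My xy]]|noy] := pselect (exists y, M n y /\ d x y < n.+1%:R^-1).
    by exists y; split; [apply: rO; exact: lt_trans nr|exists n].
  exfalso; have [sepM maxM] := MP n; apply: (maxM (M n `|` [set x])).
    split; first by move=> y; left.
    move=> /(_ x (or_intror erefl)) Mx; apply: noy; exists x; split=> //.
    by rewrite dxx invr_gt0 ltr0n.
  move=> y z [My|->] [Mz|->] yz //; first exact: sepM.
    by exfalso; apply: noy; exists y; rewrite d_sym.
  by exfalso; apply: noy; exists z.
Qed.

(** Cells of [D] are traces of open sets of [Z]. If two of these open sets met, so would their
    traces, by density of [D]. *)
Lemma dense_metrizable_cellular_on (Z : topologicalType) (D : set Z) :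
  dense D -> metrizable (set_type D) ->
  exists (M : nat -> set (set_type D)) (W : nat -> set_type D -> set Z),
    (forall n, cellular_on (M n) (W n)) /\
    dense [set val e | e in \bigcup_n M n].
Proof.
move=> dD /metrizable_cellular_on[M [V [VP tV dM]]].
have [[n e]|W WP] := @choice (nat * set_type D) (set Z) (fun p O =>
    M p.1 p.2 -> open O /\ val @^-1` O = V p.1 p.2).
  have [Me|] := pselect (M n e); last by exists set0.
  by have [[G oG <-] _] := VP n e Me; exists G.
exists M, (fun n e => W (n, e)); split=> [n|].
  split=> [e Me|e e' Me Me' We].
    have [oW WV] := WP (n, e) Me; split=> //; exists (val e).
    by have [_] := VP n e Me; rewrite -WV.
  have [oW WV] := WP (n, e) Me; have [oW' WV'] := WP (n, e') Me'.
  have [y [[Wy W'y] Dy]] := dD _ We (openI oW oW').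
  apply: (tV n) => //; exists (SigSub (mem_set Dy)).
  by move: WV WV' => /= <- <-; split.
move=> O [y Oy] oO.
have [x [Ox Dx]] := dD O (ex_intro _ y Oy) oO.
have [||e [Oe [n _ Me]]] := dM (val @^-1` O).
- by exists (SigSub (mem_set Dx)).
- by exists O.
by exists (val e); split=> //; exists e => //; exists n.
Qed.

Section cellular_families.
Variable X : topologicalType.
Local Notation Y := {ptws nat -> X}.
Variables (enc : nat * nat -> nat) (dec : nat -> nat * nat).
Hypotheses (encK : cancel enc dec).

Let row (i : nat) (y : Y) : Y := fun m => y (enc (i, m)).

Let open_row i (V : set Y) : open V -> open [set y | V (row i y)].
Proof.
move=> oV; apply: (@open_comp _ _ (row i) V) => // y _.
by apply: ptws_continuous => n; exact: ptws_eval_continuous.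
Qed.

Let glue (r : nat -> Y) : Y := fun k => r (dec k).1 (dec k).2.

Let row_glue r i : row i (glue r) = r i.
Proof. by apply/funext => m; rewrite /row /glue encK. Qed.

(** The index of a cell is the first coordinate that falls in [V1] after a run through [V0]; two
    such cells conflict at the smaller index. *)
Lemma cellular_on_nat (V0 V1 : set X) : open V0 -> open V1 ->
  V0 !=set0 -> V1 !=set0 -> V0 `&` V1 = set0 ->
  exists U : nat -> set Y, cellular_on setT U.
Proof.
move=> oV0 oV1 [x0 V0x0] [x1 V1x1] V01.
have oev n V : open V -> open [set y : Y | V (y n)].
  by move=> oV; apply: (@open_comp _ _ (fun y : Y => y n) V) => // y _; exact: ptws_eval_continuous.
exists (fun n => [set y | forall i, (i < n)%N -> V0 (y i)] `&` [set y | V1 (y n)]).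
split=> [n _|n m _ _ [y [[V0n V1n] [V0m V1m]]]].
  split; last first.
    exists (fun k => if k == n then x1 else x0); split=> [i /ltn_eqF ->//|/=].
    by rewrite eqxx.
  apply: openI; last exact: oev.
  by apply: open_forall_lt => i _; exact: oev.
have no z : V0 z -> V1 z -> False.
  by move=> z0 z1; have : (V0 `&` V1) z; [|rewrite V01].
case: (ltngtP n m) => // [nm|mn].
  by exfalso; exact: no (V0m _ nm) V1n.
by exfalso; exact: no (V0n _ mn) V1m.
Qed.

Variable N : nat -> set Y.
Hypothesis Ncell : cellular_on setT N.

Let N_inj n m y : N n y -> N m y -> n = m.
Proof. by move=> Nn Nm; have [_ tN] := Ncell; apply: tN => //; exists y. Qed.

(** Row 0 announces the summand [c] through the cells [N], and row 1 lies in a cell of [U c]. *)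
Lemma cellular_on_sum (C : countType) (T : Type) (A : C -> set T)
    (U : C -> T -> set Y) :
  (forall c, cellular_on (A c) (U c)) ->
  exists V, @cellular_on Y (C * T) [set p | A p.1 p.2] V.
Proof.
move=> cU; exists (fun p => [set y | N (pickle p.1) (row 0 y)] `&`
                        [set y | U p.1 p.2 (row 1 y)]).
split=> [[c t] /= At|[c t] [c' t'] /= At At' [y [[/= Ny Uy] [/= Ny' Uy']]]].
  have [oU [y1 Uy1]] := (cU c).1 t At.
  have [oN [y0 Ny0]] := Ncell.1 (pickle c) I.
  split; first by apply: openI; exact: open_row.
  exists (glue (fun i => if i == 0%N then y0 else y1)).
  by split; rewrite /= row_glue.
have cc' : c = c' by apply: (pcan_inj pickleK); exact: N_inj Ny Ny'.
subst c'; congr pair; apply: (cU c).2 => //.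
by exists (row 1 y).
Qed.

(** Row 0 announces the length of the list and row [i.+1] its [i]-th entry. Only finitely many rows
    are restricted, so the cells are open. *)
Lemma cellular_on_seq (T : Type) (t0 : T) (A : set T) (U : T -> set Y) :
  cellular_on A U ->
  exists V, @cellular_on Y (seq T) [set l | forall k, (k < size l)%N -> A (nth t0 l k)] V.
Proof.
move=> [oU tU]; exists (fun l => [set y | N (size l) (row 0 y)] `&`
  [set y | forall i, (i < size l)%N -> U (nth t0 l i) (row i.+1 y)]).
split=> [l Al|l l' Al Al' [y [[/= Ny Uy] [/= Ny' Uy']]]].
  have [oN [y0 Ny0]] := Ncell.1 (size l) I.
  split.
    apply: openI; first exact: open_row.
    apply: open_forall_lt => i il; apply: open_row.
    by have [] := oU _ (Al i il).
  have [i|r rP] := @choice nat Y (fun i z => (i < size l)%N -> U (nth t0 l i) z).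
    have [il|] := boolP (i < size l)%N; last by exists y0.
    by have [_ [z Uz]] := oU _ (Al i il); exists z.
  exists (glue (fun i => if i is j.+1 then r j else y0)).
  by split=> [|i il] /=; rewrite row_glue //; exact: rP.
have sE : size l = size l' by exact: N_inj Ny Ny'.
apply: (@eq_from_nth _ t0) => // i il; apply: tU; [exact: Al|by apply: Al'; rewrite -sE|].
by exists (row i.+1 y); split; [exact: Uy|apply: Uy'; rewrite -sE].
Qed.

End cellular_families.

(** * A base indexed by finite lists *)

Section weight.
Variables (X : topologicalType) (I : Type) (F : I -> X -> R).
Hypothesis Xcompact : compact [set: X].
Hypothesis Fcont : forall i, continuous (F i).
Hypothesis Fsep : forall y z, (forall i, F i y = F i z) -> y = z.
Hypothesis Fcount : forall z, countable [set i | F i z <> 0].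

(* The coordinates in the supports of a dense set of points separate points,
   since every other coordinate vanishes identically. *)
Lemma basis_of_dense (T : choiceType) (t0 : T) (p : T -> X) (M : nat -> set T) :
  dense [set p e | e in \bigcup_n M n] ->
  exists box : seq ((nat * nat * rat * nat) * T) -> set X,
    basis (box @` [set l | forall k, (k < size l)%N ->
      let t := nth ((0%N, 0%N, 0%Q, 0%N), t0) l k in M t.1.1.1.1 t.2]).
Proof.
move=> dM.
have [x|h hP] := @choice X (nat -> X -> R) (fun x h => (forall k, continuous (h k)) /\
    forall i, F i x <> 0 -> exists k, h k = F i).
  have /countable_injP[c cinj] := Fcount x.
  have [k|h hP] := @choice nat (X -> R) (fun k f => continuous f /\
      forall i, F i x <> 0 -> c i = k -> f = F i).
    have [[i [ix ik]]|no] := pselect (exists i, F i x <> 0 /\ c i = k).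
      exists (F i); split=> // j jx jk; congr F.
      by apply: cinj; rewrite ?inE // jk.
    exists (fun=> 0); split=> [z|i ix ik]; first exact: cvg_cst.
    by exfalso; apply: no; exists i.
  exists h; split=> [k|i ix]; first by have [] := hP k.
  by exists (c i); have [_ /(_ i ix erefl)] := hP (c i).
pose psi (q : nat * nat * T) : X -> R := h (p q.2) q.1.2.
pose J := [set q : nat * nat * T | M q.1.1 q.2].
have psic q : continuous (psi q) by have [+ _] := hP (p q.2); apply.
have psisep x y : (forall q, J q -> psi q y = psi q x) -> y = x.
  move=> yx; apply: Fsep => i.
  have [[e [n Me ie]]|no] :=
      pselect (exists e, exists2 n, M n e & F i (p e) <> 0).
    have [_ /(_ i ie)[k hk]] := hP (p e).
    by have := yx (n, k, e) Me; rewrite /psi /= hk.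
  suff i0 z : F i z = 0 by rewrite !i0.
  apply: contrapT => /eqP iz.
  have [||w [iw [e [n _ Me] ew]]] := dM (~` [set z | F i z = 0]).
  - by exists z; exact/eqP.
  - by apply: closed_openC; exact: closed_fiber.
  by apply: no; exists e, n; rewrite // ew.
pose t1 : (nat * nat * rat * nat) * T := ((0%N, 0%N, 0%Q, 0%N), t0).
(* An entry [((n, k, r, m), e)] keeps the [k]-th function attached to [p e] within 1/(m+1) of the
   rational [r]; [n] records the set [M n] from which [e] comes. *)
pose box (l : seq ((nat * nat * rat * nat) * T)) : set X :=
  [set x | forall k, (k < size l)%N -> let t := nth t1 l k in
    `|psi (t.1.1.1, t.2) x - ratr t.1.1.2| < t.1.2.+1%:R^-1].
exists box; split=> [_ [l _ <-]|x W].
  apply: open_forall_lt => k _; rewrite openE => y /= yk.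
  have := continuous_near (psic (((nth t1 l k).1.1.1), (nth t1 l k).2)) y.
  move=> /(_ ((nth t1 l k).1.2.+1%:R^-1 -
    `|psi ((nth t1 l k).1.1.1, (nth t1 l k).2) y - ratr (nth t1 l k).1.1.2|)).
  rewrite subr_gt0 => /(_ yk); apply: filterS => z /= zy.
  apply: le_lt_trans (ler_distD (psi ((nth t1 l k).1.1.1, (nth t1 l k).2) y) _ _) _.
  by rewrite -ltrBrDr.
rewrite nbhsE => -[W' [oW' W'x] W'W].
have [z zx|S [fS SJ [e e0 eW]]] :=
    @compact_separating_base X _ psi J x W' Xcompact (fun q _ => @psic q) oW'.
  by rewrite (psisep x z).
have /finite_seqP[s Ss] := fS.
(* The tolerance is at most half of [e], as it is spent twice: from [x] to the rational and from the
   rational to [z]. *)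
have [m me] : exists m : nat, m.+1%:R^-1 < e / 2.
  have e20 : 0 < e / 2 by rewrite divr_gt0.
  by have [m] := ltr_add_invr e20; rewrite add0r => me; exists m.
have m0 : (0 : R) < m.+1%:R^-1 by rewrite invr_gt0 ltr0n.
have [q|r rP] := @choice (nat * nat * T)%type rat (fun q r =>
    `|psi q x - ratr r| < m.+1%:R^-1).
  have [|r] := @rat_in_itvoo R (psi q x) (psi q x + m.+1%:R^-1); first by rewrite ltrDl.
  rewrite in_itv /= => /andP[r1 r2]; exists r.
  rewrite ltr_distlC r2 andbT; apply: lt_trans r1.
  by rewrite ltrBlDr ltrDl.
pose l := [seq ((q.1, r q, m), q.2) | q <- s].
have nl k : (k < size l)%N -> exists2 q, S q & nth t1 l k = ((q.1, r q, m), q.2).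
  rewrite size_map => ks; have := mem_nth ((0%N, 0%N), t0) ks.
  move=> qs; exists (nth ((0%N, 0%N), t0) s k); first by rewrite Ss.
  by rewrite (nth_map ((0%N, 0%N), t0)).
exists (box l).
  split; first by exists l => // k /nl[q /SJ Sq ->].
  by move=> k /nl[q Sq ->] /=; rewrite -surjective_pairing.
move=> z boxz; apply: W'W; apply: eW => q; rewrite Ss /= => qs.
have il : (index q s < size l)%N by rewrite size_map index_mem.
have := boxz _ il; rewrite /= (nth_map ((0%N, 0%N), t0)) ?index_mem // nth_index //=.
rewrite -surjective_pairing => zq.
apply: le_lt_trans (ler_distD (ratr (r q)) _ _) _.
rewrite [ltRHS]splitr ltrD ?(lt_trans _ me) //.
by rewrite distrC; exact: rP.
Qed.

End weight.

(* X^omega = {ptws nat -> X} with the product topology;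
   hat c(X^omega) > w(X) is expressed via a base B of X of minimal
   cardinality (|B| = w(X)). *)
Theorem theorem3 (X : topologicalType) :
  corson_compact X ->
  (has_dense_metrizable_subspace {ptws nat -> X} <->
   exists B : set (set X), minimal_base B /\ hatc_gt {ptws nat -> X} B).
Proof.
move=> [Xcompact [XH [I [f [[finj [fcont _]] fSigma]]]]].
pose F (i : I) (x : X) : Rdefinitions.R := f x i.
have Fcont i : continuous (F i).
  move=> x; apply: (@continuous_comp _ _ _ f (fun y : {ptws I -> Rdefinitions.R} => y i)).
    exact: fcont.
  exact: (@proj_continuous {classic I} (fun=> Rdefinitions.R) i).
have Fsep y z : (forall i, F i y = F i z) -> y = z.
  by move=> yz; apply: finj; apply/funext => i; exact: yz.
have [enc [dec encK decK]] := nat_pairing.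
split=> [[D [dD mD]]|[B [[bB _] cB]]]; last first.
  (* For empty [X] the power is empty and the empty subspace serves; otherwise [x0] supplies default
     values. *)
  have [[x0 _]|noX] := pselect ([set: X] !=set0); last first.
    exists set0; split.
      by move=> W [y _] _; exfalso; apply: noX; exists (y 0%N).
    have no (y : set_type (set0 : set {ptws nat -> X})) : False := set_valP y.
    apply: (@metrizable_of_labels _ unit (fun _ _ => tt) (fun _ _ _ _ => 0%R)).
    - by move=> n y; case: (no y).
    - by move=> n s k y; case: (no y).
    - by move=> y; case: (no y).
    - by move=> y; case: (no y).
  have [C [[Copen Cdisj] /card_esym/pcard_eqP/bijPex[U [UC Uinj _]]]] :=
    cB B (@subset_refl _ B).
  apply: (@ptws_dense_metrizable X B Xcompact XH _ bB U _ _ enc dec encK decK x0).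
  - exact: (@dense_countably_determined X I F Xcompact Fcont Fsep fSigma).
  - by move=> b /UC/Copen.
  - move=> b b' Bb Bb' /set0P/eqP bb'; apply: Uinj; rewrite ?inE //.
    by apply: contrapT => /(Cdisj _ _ (UC _ Bb) (UC _ Bb')).
(* With at most one point there are no two disjoint non-empty open sets to start from. Here [setT]
   alone is a base and a cellular family; the clause [W !=set0] empties both when [X] is empty. *)
have [subX|] := pselect (forall x y : X, x = y).
  apply: (@hatc_gt_min_base _ _ _ [set W : set X | W = setT /\ W !=set0] (fun=> setT)
    [set W : set X | W = setT /\ W !=set0]).
  - split=> [_ [-> _]|x W xW]; first exact: openT.
    exists setT => [|z _ /=]; first by split=> //; split=> //; exists x.
    by rewrite -(subX x z); exact: nbhs_singleton.
  - exact: card_lexx.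
  - split=> [W [_ [x _]]|W W' [-> _] [-> _] //].
    by split; [exact: openT|exists (fun=> x)].
move=> /existsNP[x0 /existsNP[x1 /eqP x01]].
have := XH; rewrite open_hausdorff => /(_ _ _ x01)[[V0 V1] /= [V0x V1x] [oV0 oV1 /eqP V01]].
rewrite !inE in V0x V1x.
have [N Ncell] := cellular_on_nat oV0 oV1 (ex_intro _ _ V0x) (ex_intro _ _ V1x) V01.
have [M [W [cW dM]]] := dense_metrizable_cellular_on dD mD.
have [y [_ Dy]] := dD setT (ex_intro _ (fun=> x0) Logic.I) openT.
pose t0 : set_type D := SigSub (mem_set Dy).
(* The countable summand carries the data [(n, k, r, m)], so that the same finite lists index the
   cells of the power and the boxes of [basis_of_dense]. *)
have [V cV] := cellular_on_sum encK Ncell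
  (A := fun c : nat * nat * rat * nat => M c.1.1.1) (fun c => cW c.1.1.1).
have [V' cV'] := cellular_on_seq encK Ncell ((0%N, 0%N, 0%Q, 0%N), t0) cV.
have [|box bbox] := @basis_of_dense X I F Xcompact Fcont Fsep fSigma (set_type D) t0
  (fun e => val e 0%N) M _.
  (* The coordinates at 0 of a dense set of sequences are dense in [X]. *)
  move=> G [x Gx] oG; have [||z [Gz [e Me ez]]] := dM [set z | G (z 0%N)].
  - by exists (fun=> x).
  - by apply: open_comp oG => z _; exact: ptws_eval_continuous.
  by exists (z 0%N); split=> //; exists e; rewrite // ez.
apply: (hatc_gt_min_base bbox (card_image_le _ _) cV').
Qed.
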